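(* Let $1<p<\infty$ with $p\neq2$, and let $d\in\mathbb{N}$ with $d>2$. Then: (a) $T_{d,p}$ is attained, i.e. $T_{d,p}=t_f$, for some nonzero $f(z)=\sum_{k=0}^d a_kz^k\in\mathscr{P}_d$ with real nonnegative coefficients that satisfy, with $t=T_{d,p}$ and $a_{-1}=a_{d+1}=0$, the recurrence relation $$(p\,a_kt-a_{k+1})\,|a_{k+1}-ta_k|^{p-2}=(p-1)\,a_{k-1}\,|a_k-ta_{k-1}|^{p-2},\qquad 0\le k\le d.$$ (b) For that choice of $f$, $T_{d,p}$ is the unique solution to the equation $h'(T_{d,p})=0$, where $h(s)=\|(1-sz)f(z)\|_p^p$ for $s\in\mathbb{R}$.
   Context: For $1<p<\infty$, $\ell^p_A$ is the Banach space of power series $f(z)=\sum_{k\ge 0}a_kz^k$ (complex coefficients) with $\|f\|_p=\left(\sum_{k\ge0}|a_k|^p\right)^{1/p}<\infty$. $\mathscr{P}_d$ is the space of complex polynomials of degree at most $d$. For nonzero $f\in\ell^p_A$, $t_f$ denotes the unique complex number with $\|(1-t_fz)f(z)\|_p=\min_{t\in\mathbb{C}}\|(1-tz)f(z)\|_p$. For $d\in\mathbb{N}$, $T_{d,p}:=\sup\{|t_f|: f\in\mathscr{P}_d,\ f\neq0\}$. *)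

(* Defs.v *)
From HB Require Import structures.
From mathcomp Require Import all_boot all_order all_algebra.
From mathcomp Require Import all_classical all_reals all_analysis.
From mathcomp Require Import complex.
Import Order.TTheory GRing.Theory Num.Theory.
Import numFieldNormedType.Exports.

Set Implicit Arguments.
Unset Strict Implicit.
Unset Printing Implicit Defensive.

Local Open Scope classical_set_scope.
Local Open Scope ring_scope.
Local Open Scope complex_scope.

(* A power series sum_k a_k z^k is represented by its coefficient sequence
   a : nat -> V. *)

(* k |-> a_(k-1), with a_(-1) = 0: the coefficients of z f(z). *)
Definition prevcoef (V : nmodType) (a : nat -> V) (k : nat) : V :=
  if k is j.+1 then a j else 0.

(* The coefficients of (1 - t z) f(z). *)
Definition mul_1subtz (A : pzRingType) (t : A) (a : nat -> A) (k : nat) : A :=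
  a k - t * prevcoef a k.

Definition coefs (A : nzSemiRingType) (f : {poly A}) (k : nat) : A := f`_k.

(* The modulus as an element of R (the library's `|z| is an element of R[i]). *)
Definition modulus (R : realType) (z : R[i]) : R := ComplexField.Normc.normc z.

(* l^p_A is the set of sequences a with lpnorm p a < +oo. *)
Definition lpnorm (R : realType) (p : R) (a : nat -> R[i]) : \bar R :=
  ((\sum_(0 <= k <oo) (modulus (a k) `^ p)%:E) `^ p^-1)%E.

Definition is_minimizer (R : realType) (p : R) (a : nat -> R[i]) (t : R[i]) :=
  forall s : R[i],
    (lpnorm p (mul_1subtz t a) <= lpnorm p (mul_1subtz s a))%E.

(* t_f, for the f in l^p_A with coefficient sequence a; meaningful only when
   f is nonzero, in which case the minimizer exists and is unique. *)
Definition tmin (R : realType) (p : R) (a : nat -> R[i]) : R[i] :=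
  xget 0 [set t | is_minimizer p a t].

(* T_(d,p), as an extended real so that an unbounded set has supremum +oo. *)
Definition Tsup (R : realType) (d : nat) (p : R) : \bar R :=
  ereal_sup [set (modulus (tmin p (coefs f)))%:E |
             f in [set f : {poly R[i]} | (size f <= d.+1)%N /\ f != 0]].

(* h(s) = || (1 - s z) f(z) ||_p ^ p. *)
Definition hfun (R : realType) (p : R) (f : {poly R[i]}) (s : R) : R :=
  fine (lpnorm p (mul_1subtz s%:C (coefs f)) `^ p)%E.

(* Main.v *)
(* Let phi(x) = x |x|^(p-2).  By convexity t_f is governed by the sign of
   J(f, t) = sum_k Re (phi(a_k - t a_(k-1)) conj(a_(k-1))), which is positively
   homogeneous and couples only consecutive coefficients, so its maximization is
   a dynamic programme.  With x = t^p and G(w) = min_(s >= 0) (w s^p - phi(s - 1)),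
   the optimal value with n steps to go is - t^(p-1) W_n(x) |a|^p, where W_0 = 1
   and W_(n+1) = G(x W_n).  The threshold T is given by W_d(T^p) = 0, and the
   optimal ratios a_(k+1) / a_k at the threshold give the extremal f; the
   recurrence is the first-order condition for these minimizations.
   Complex coefficients give no larger T: for g >= 0, the bound
   phi(s - 1) <= w s^p - g for all s >= 0 implies Re phi(z - 1) <= w |z|^p - g
   for every complex z. *)

Require Import Defs.
From HB Require Import structures.
From mathcomp Require Import all_boot all_order all_algebra.
From mathcomp Require Import all_classical all_reals all_analysis.
From mathcomp Require Import complex.
From mathcomp Require Import ring lra.
Import Order.TTheory GRing.Theory Num.Theory.
Import numFieldNormedType.Exports.
Local Open Scope classical_set_scope.
Local Open Scope ring_scope.
Local Open Scope complex_scope.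

(** * Real powers *)

Section RealPowers.
Set Implicit Arguments.
Unset Strict Implicit.
Context {R : realType}.
Implicit Types (p q x y a b l : R).

Lemma powR_tangent p a b : 1 < p -> 0 <= a -> 0 <= b ->
  b `^ p + p * b `^ (p - 1) * (a - b) <= a `^ p.
Proof.
move=> p1 a0 b0; have p0 : 0 < p by lra.
have q0 : 0 < p / (p - 1) by rewrite divr_gt0//; lra.
have pq : p^-1 + (p / (p - 1))^-1 = 1 by field; apply/andP; split; lra.
have := conjugate_powR a0 (powR_ge0 b (p - 1)) p0 q0 pq.
rewrite -powRrM (_ : (p - 1) * (p / (p - 1)) = p); last by field; lra.
rewrite -(ler_pM2l p0).
have -> : p * (a `^ p / p + b `^ p / (p / (p - 1))) = a `^ p + b `^ p * (p - 1).
  by field; apply/andP; split; lra.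
by rewrite -(mulr_powRB1 b0 p0); lra.
Qed.

(** The tangent to the [q]-th power at [x], evaluated at the mean of [x] and [y] with weights
    [(q - 1) / q] and [1 / q]. *)
Lemma powR_weighted_AMGM q x y : 1 < q -> 0 <= x -> 0 <= y ->
  x `^ (q - 1) * y <= (((q - 1) * x + y) / q) `^ q.
Proof.
move=> q1 x0 y0; have q0 : 0 < q by lra.
have h : 0 <= ((q - 1) * x + y) / q.
  by rewrite divr_ge0 ?addr_ge0 ?mulr_ge0//; lra.
have := powR_tangent q1 h x0.
have -> : ((q - 1) * x + y) / q - x = (y - x) / q by field; lra.
have -> : q * x `^ (q - 1) * ((y - x) / q) = x `^ (q - 1) * (y - x).
  by field; lra.
by rewrite -(mulr_powRB1 x0 q0); lra.
Qed.

Lemma powR_convex_comb p x y l : 1 <= p -> 0 <= x -> 0 <= y -> 0 <= l <= 1 ->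
  (l * x + (1 - l) * y) `^ p <= l * x `^ p + (1 - l) * y `^ p.
Proof.
move=> p1 x0 y0 /andP[l0 l1].
have := @convex_powR R p p1 (Itv01 l0 l1) x y.
by rewrite !convRE/=; apply; rewrite inE/= in_itv/= andbT.
Qed.

(** Convexity of the power [p^-1] at the points [x]^ p[and]y [^ p], raised to the power [p]. *)
Lemma powR_concave_comb p x y l : 0 < p -> p <= 1 -> 0 <= x -> 0 <= y ->
  0 <= l <= 1 -> l * x `^ p + (1 - l) * y `^ p <= (l * x + (1 - l) * y) `^ p.
Proof.
move=> p0 p1 x0 y0 l01; case/andP: (l01) => l0 l1.
have ip : 1 <= p^-1 by rewrite invf_ge1.
have := powR_convex_comb ip (powR_ge0 x p) (powR_ge0 y p) l01.
rewrite -!powRrM mulfV ?gt_eqF// !powRr1// => h.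
have s0 : 0 <= l * x `^ p + (1 - l) * y `^ p.
  by rewrite addr_ge0 ?mulr_ge0 ?powR_ge0//; lra.
have := ge0_ler_powR (ltW p0) _ _ h.
rewrite -powRrM mulVf ?gt_eqF// powRr1//; apply; rewrite nnegrE ?powR_ge0//.
by rewrite addr_ge0 ?mulr_ge0//; lra.
Qed.

Lemma sqr_powR (x a : R) : 0 <= x -> (x ^+ 2) `^ a = x `^ (2 * a).
Proof. by move=> x0; rewrite powRrM powR_mulrn. Qed.

Lemma powRV (x a : R) : 0 < x -> x^-1 `^ a = (x `^ a)^-1.
Proof.
move=> x0; rewrite -(powR_inv1 (ltW x0)) -powRrM mulN1r powRN.
by [].
Qed.

Lemma powR_le_id (x a : R) : 0 <= x <= 1 -> 1 <= a -> x `^ a <= x.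
Proof.
move=> /andP[x0 x1] a1; have [->|xn0] := eqVneq x 0.
  by rewrite powR0//; lra.
by apply: ge1r_powR => //; rewrite lt0r xn0 x0.
Qed.

End RealPowers.

(** The function phi of the overview. The factor [x] gives it the value 0 at 0 also when [p < 2]. *)
Definition spow {R : realType} (p x : R) : R := x * `|x| `^ (p - 2).

Section SignedPower.
Set Implicit Arguments.
Unset Strict Implicit.
Context {R : realType} {p : R} (hp : 1 < p).

Lemma spow0 : spow p 0 = 0. Proof. by rewrite /spow mul0r. Qed.

Lemma spow_ge0E x : 0 <= x -> spow p x = x `^ (p - 1).
Proof.
have p1 := hp; move=> x0; rewrite /spow ger0_norm//.
have [->|xn0] := eqVneq x 0; first by (rewrite mul0r powR0//; lra).
rewrite (_ : p - 2 = p - 1 - 1); last ring.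
by rewrite mulr_powRB1//; lra.
Qed.

Lemma spowN x : spow p (- x) = - spow p x.
Proof. by rewrite /spow normrN mulNr. Qed.

Lemma spow_le0E x : x <= 0 -> spow p x = - (- x) `^ (p - 1).
Proof. by move=> x0; rewrite -spow_ge0E ?oppr_ge0// spowN opprK. Qed.

Lemma mul_spow x : x * spow p x = `|x| `^ p.
Proof.
have p1 := hp; have [x0|/ltW x0] := leP 0 x.
  by rewrite spow_ge0E// ger0_norm// mulr_powRB1//; lra.
rewrite spow_le0E// ler0_norm// mulrN -mulNr mulr_powRB1 ?oppr_ge0//; lra.
Qed.

Lemma ltr_spow : {homo spow p : x y / x < y}.
Proof.
have p1 := hp; have pos x y : 0 <= x -> x < y -> spow p x < spow p y.
  move=> x0 xy; rewrite !spow_ge0E//; last by lra.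
  by apply: gt0_ltr_powR => //; rewrite ?nnegrE; lra.
move=> x y xy; have [x0|x0] := leP 0 x; first exact: pos.
have [y0|y0] := leP 0 y; last first.
  by rewrite -ltrN2 -!spowN pos; lra.
have : spow p 0 < spow p (- x) by apply: pos; lra.
have : spow p 0 <= spow p y by rewrite spow0 spow_ge0E// powR_ge0.
rewrite spow0 spowN; lra.
Qed.

Lemma ler_spow : {homo spow p : x y / x <= y}.
Proof. by move=> x y; rewrite le_eqVlt => /predU1P[->//|/ltr_spow/ltW]. Qed.

End SignedPower.

(** * Passing from real to complex arguments *)

Section ComplexBound.
Set Implicit Arguments.
Unset Strict Implicit.
Context {R : realType} {p : R} (hp : 1 < p).
Context {w g : R} (g0 : 0 <= g).
Hypothesis wg : forall s : R, 0 <= s -> spow p (s - 1) <= w * s `^ p - g.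

Lemma gap_le_weight : g <= w.
Proof. by have := wg ler01; rewrite subrr spow0 powR1; lra. Qed.

(* Below, [r = |z|], [s = |z - 1|] and [y = Re z - 1] for a complex [z]. *)
Variables r s y : R.
Hypotheses (r0 : 0 <= r) (s0 : 0 <= s) (ys : - s <= y <= s).
Hypothesis rE : r ^+ 2 = s ^+ 2 + 2 * y + 1.

(** By [rE], [r ^+ 2 - (y + 1) ^+ 2 = s ^+ 2 - y ^+ 2], which is nonnegative by [ys]. *)
Lemma modulus_ge_Re : y + 1 <= r.
Proof.
have [h|h] := leP (y + 1) 0; first exact: le_trans r0.
rewrite -(@ler_pXn2r _ 2) ?nnegrE//; last exact: ltW.
have := ys => /andP[? ?]; have e := rE; rewrite e; nra.
Qed.

(* With [s] fixed, the left-hand side is affine and [r ^ p] concave in [y], so it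
   suffices to look at [y = s] and [y = - s], where [z] is real. *)
Lemma planar_bound_lt2 : p <= 2 -> s `^ (p - 2) * y <= w * r `^ p - g.
Proof.
move=> p2; have p1 := hp; have gw := gap_le_weight; have ? := g0.
have e := rE; have ys' := ys; case/andP: (ys') => y1 y2.
have [sz|sn0] := eqVneq s 0.
  have yz : y = 0 by lra.
  have -> : r = 1.
    by apply/eqP; rewrite -(@eqrXn2 _ 2)// e sz yz; apply/eqP; ring.
  by rewrite yz powR1; lra.
have sgt0 : 0 < s by rewrite lt0r sn0 s0.
(* [l] writes [y] as the convex combination of [s] and [- s]; the same weights express [r ^+ 2]
   through the squares of [1 + s] and [1 - s]. *)
pose l := (1 + y / s) / 2.
have ysE : s * (y / s) = y by rewrite mulrC divfK.
have l01 : 0 <= l <= 1.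
  have : y / s <= 1 by rewrite ler_pdivrMr// mul1r.
  have : -1 <= y / s by rewrite ler_pdivlMr// mulN1r.
  by rewrite /l; lra.
have yl : y = s * (2 * l - 1) by rewrite /l -[LHS]ysE; field.
have q0 : 0 < p / 2 by lra.
have q1 : p / 2 <= 1 by lra.
have := powR_concave_comb q0 q1 (sqr_ge0 (1 + s)) (sqr_ge0 `|1 - s|) l01.
rewrite !sqr_powR ?normr_ge0//; last lra.
have -> : 2 * (p / 2) = p by field.
rewrite real_normK ?num_real//.
have -> : l * (1 + s) ^+ 2 + (1 - l) * (1 - s) ^+ 2 = r ^+ 2.
  by rewrite e yl; ring.
rewrite sqr_powR// (_ : 2 * (p / 2) = p); last by field.
move=> hr.
have hplus : s `^ (p - 1) <= w * (1 + s) `^ p - g.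
  rewrite -spow_ge0E//; have := @wg (1 + s).
  by rewrite (_ : 1 + s - 1 = s); [apply; lra | ring].
have hminus : - s `^ (p - 1) <= w * `|1 - s| `^ p - g.
  have [s1|s1] := leP s 1.
    have := @wg (1 - s); rewrite (_ : 1 - s - 1 = - s); last ring.
    rewrite spowN spow_ge0E// ger0_norm; last lra.
    by apply; lra.
  have := @wg 0 (lexx _); rewrite sub0r spowN spow_ge0E// powR1.
  rewrite powR0; last lra.
  have : 1 <= s `^ (p - 1).
    have := @ge0_ler_powR R (p - 1) _ 1 s.
    rewrite powR1; apply; rewrite ?nnegrE; lra.
  have : 0 <= `|1 - s| `^ p by exact: powR_ge0.
  nra.
have -> : s `^ (p - 2) * y = (2 * l - 1) * s `^ (p - 1).
  by rewrite yl -(spow_ge0E hp s0) /spow ger0_norm//; ring.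
have hw : w * (l * (1 + s) `^ p + (1 - l) * `|1 - s| `^ p) <= w * r `^ p.
  by apply: ler_wpM2l => //; lra.
case/andP: l01 => l0 l1; nra.
Qed.

(** Weighted AM-GM with exponent [p / 2], after scaling by [b]. Equality holds at [s = y = b], so
    [b] selects the real point [1 + b] at which the bound is exact. *)
Lemma planar_AMGM (b : R) : 2 < p -> 0 < b -> 0 <= y ->
  s `^ (p - 2) * y <=
  b `^ (p - 1) * (((p / 2 - 1) * (s / b) ^+ 2 + y / b) / (p / 2)) `^ (p / 2).
Proof.
move=> p2 b0 y0; have q1 : 1 < p / 2 by lra.
have sb0 : 0 <= s / b by rewrite divr_ge0// ltW.
have yb0 : 0 <= y / b by rewrite divr_ge0// ltW.
have := powR_weighted_AMGM q1 (sqr_ge0 (s / b)) yb0.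
rewrite sqr_powR// (_ : 2 * (p / 2 - 1) = p - 2); last by field.
rewrite -(ler_pM2l (powR_gt0 (p - 1) b0)); apply: le_trans.
rewrite -{1}[s](divfK (lt0r_neq0 b0)) (powRM _ sb0 (ltW b0)).
rewrite -(spow_ge0E hp (ltW b0)) /spow gtr0_norm//.
rewrite le_eqVlt; apply/orP; left; apply/eqP; field; lra.
Qed.

(* If [r <= 1] or [p - 1 <= r], the real point [r] is the worst on its circle.  In
   between, weighted AM-GM gives an upper envelope proportional to
   [(r ^ 2 - 1) ^ (p / 2)], exact at the real points [1] and [p - 1], and convexity
   in [r ^ -2] reduces the bound to these two. *)
Lemma planar_bound_gt2 : 2 < p -> s `^ (p - 2) * y <= w * r `^ p - g.
Proof.
move=> p2; have p1 := hp; have gw := gap_le_weight; have ? := g0.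
have e := rE; have ys' := ys; case/andP: (ys') => y1 y2.
have yr := modulus_ge_Re.
have rp0 : 0 <= r `^ p := powR_ge0 _ _.
have [y0|y0] := leP y 0.
  have [r1|r1] := leP 1 r.
    have : 1 <= r `^ p.
      have := @ge0_ler_powR R p _ 1 r.
      by rewrite powR1; apply; rewrite ?nnegrE; lra.
    have : 0 <= s `^ (p - 2) := powR_ge0 _ _.
    nra.
  (* The real point [r] is worst here: [y <= r - 1 < 0] and [1 - r <= s]. *)
  apply: le_trans (wg r0).
  rewrite -[r - 1]opprB spowN spow_ge0E//; last lra.
  have -> : (1 - r) `^ (p - 1) = (1 - r) `^ (p - 2) * (1 - r).
    by rewrite -(spow_ge0E hp) /spow ?ger0_norm ?(mulrC (1 - r))//; lra.
  have : (1 - r) `^ (p - 2) <= s `^ (p - 2).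
    by apply: ge0_ler_powR; rewrite ?nnegrE; lra.
  have : 0 <= (1 - r) `^ (p - 2) := powR_ge0 _ _.
  nra.
have r1 : 1 < r by lra.
have [rp|rp] := leP (p - 1) r.
  apply: le_trans (wg r0); rewrite spow_ge0E//; last lra.
  have b0 : 0 < r - 1 by lra.
  apply: le_trans (planar_AMGM p2 b0 (ltW y0)) _.
  rewrite -[leRHS]mulr1; apply: ler_wpM2l; first exact: powR_ge0.
  apply: (@le_trans _ _ (1 `^ (p / 2))); last by rewrite powR1.
  apply: ge0_ler_powR; rewrite ?nnegrE; [lra| |exact: ler01|].
    apply: divr_ge0; last lra.
    by apply: addr_ge0; [apply: mulr_ge0; [lra|exact: sqr_ge0]|apply: divr_ge0; lra].
  rewrite ler_pdivrMr ?mul1r; last lra.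
  rewrite -(ler_pM2r (exprn_gt0 2 b0)).
  have -> : ((p / 2 - 1) * (s / (r - 1)) ^+ 2 + y / (r - 1)) * (r - 1) ^+ 2
      = (p / 2 - 1) * s ^+ 2 + y * (r - 1).
    by field; lra.
  have -> : s ^+ 2 = r ^+ 2 - 1 - 2 * y by rewrite e; ring.
  (* With [s ^+ 2] eliminated, the right-hand side minus the left-hand side is exactly this
     product. *)
  have : 0 <= (r - 1 - y) * (r - 1 - (p - 2)) by rewrite mulr_ge0//; lra.
  by nra.
pose P := (p - 1) ^+ 2; have P1 : 1 < P by rewrite /P; nra.
have r21 : 1 < r ^+ 2 by nra.
have r2P : r ^+ 2 < P by rewrite /P; nra.
(* [l] solves [(r ^+ 2)^-1 = l * P^-1 + (1 - l)]: it is the weight of the real point [p - 1] against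
   the real point 1. *)
pose l := (r ^+ 2 - 1) / r ^+ 2 * (P / (P - 1)).
have l01 : 0 <= l <= 1.
  rewrite /l; apply/andP; split.
    by rewrite mulr_ge0 // divr_ge0//; lra.
  rewrite mulf_div ler_pdivrMr ?mul1r; nra.
have b0 : 0 < p - 2 by lra.
have := planar_AMGM p2 b0 (ltW y0).
have -> : ((p / 2 - 1) * (s / (p - 2)) ^+ 2 + y / (p - 2)) / (p / 2)
    = r ^+ 2 / P * l.
  have -> : y = (r ^+ 2 - s ^+ 2 - 1) / 2 by rewrite e; field.
  rewrite /l /P; field; rewrite /P in P1; do ?[apply/andP; split]; nra.
have l0 : 0 <= l by case/andP: l01.
have l1 : l <= 1 by case/andP: l01.
pose D := (p - 1) `^ p; have D0 : 0 < D by apply: powR_gt0; lra.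
have pE : 2 * (p / 2) = p by field.
have P0 : 0 < P by lra.
have PD : P `^ (p / 2) = D by rewrite sqr_powR ?pE//; lra.
have rr : (r ^+ 2) `^ (p / 2) = r `^ p by rewrite sqr_powR// pE.
have iP : 0 <= P^-1 by rewrite invr_ge0; lra.
have rP0 : 0 <= r ^+ 2 / P by rewrite mulr_ge0// sqr_ge0.
rewrite (powRM _ rP0 l0) (powRM _ (sqr_ge0 r) iP) rr (powRV _ P0) PD.
set N := (p - 2) `^ (p - 1) => hN.
have N0 : 0 <= N := powR_ge0 _ _.
have lq : l `^ (p / 2) <= l by apply: powR_le_id; lra.
have wN : N <= w * D - g.
  have := @wg (p - 1); rewrite (_ : p - 1 - 1 = p - 2); last ring.
  by rewrite spow_ge0E//; [apply; lra | lra].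
have conv : g <= g * (r `^ p * ((1 - l) + l * D^-1)).
  rewrite -[leLHS]mulr1 ler_wpM2l//.
  have := @powR_convex_comb R (p / 2) P^-1 1 l _ iP ler01 l01.
  rewrite powR1 (powRV _ P0) PD mulr1 => /(_ ltac:(lra)) hc.
  have hE : r `^ p * (l * P^-1 + (1 - l)) `^ (p / 2) = 1.
    rewrite -rr -powRM ?sqr_ge0//; last by (apply: addr_ge0; [exact: mulr_ge0|lra]).
    rewrite (_ : r ^+ 2 * _ = 1) ?powR1//.
    rewrite /l; field; do ?[apply/andP; split]; nra.
  by rewrite -[X in X <= _]hE ler_wpM2l//; lra.
apply: le_trans hN _.
have step1 : N * (r `^ p * D^-1 * l `^ (p / 2)) <= (w * D - g) * (r `^ p * D^-1 * l).
  apply: ler_pM => //; first by rewrite !mulr_ge0 ?powR_ge0 ?invr_ge0// ltW.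
  by apply: ler_wpM2l => //; rewrite mulr_ge0 ?invr_ge0// ltW.
apply: le_trans step1 _.
have -> : (w * D - g) * (r `^ p * D^-1 * l) = w * (r `^ p * l) - g * (r `^ p * (l * D^-1)).
  by field; rewrite gt_eqF.
have : 0 <= (w - g) * (r `^ p * (1 - l)) by rewrite !mulr_ge0//; lra.
nra.
Qed.

(** The left-hand side is Re phi(z - 1), so the bound [wg] on the half-line extends to every complex
    z. *)
Lemma planar_bound : s `^ (p - 2) * y <= w * r `^ p - g.
Proof.
have [p2|p2] := leP p 2; first exact: planar_bound_lt2.
exact: planar_bound_gt2.
Qed.

End ComplexBound.

(** * Derivatives *)

Section Derivatives.
Set Implicit Arguments.
Unset Strict Implicit.
Context {R : realType}.
Implicit Types (p x a : R).

(** The difference quotient at 0 is [g] itself, so [g] may fail to be differentiable there, as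
    fractional powers of [|x|] do. *)
Lemma is_derive_mulx (g : R -> R) : {for 0, continuous g} ->
  is_derive (0 : R) 1 (fun x => x * g x) (g 0).
Proof.
move=> cg.
have h : (h^-1 *: (((fun x => x * g x) \o shift 0) (h *: 1) - 0 * g 0)
    @[h --> (0 : R)^']) --> g 0.
  apply: (@cvg_trans _ (g h @[h --> (0 : R)^'])).
    apply: near_eq_cvg; near=> h.
    have h0 : h != 0 by near: h; exact: nbhs_dnbhs_neq.
    by rewrite /= addr0 mul0r subr0 /GRing.scale/= mulr1 mulKf.
  exact: cvg_within_filter.
by apply: DeriveDef; [apply: cvgP h | exact: cvg_lim h].
Unshelve. all: by end_near. Qed.

Lemma cvg_powR_norm0 a : 0 < a -> {for (0 : R), continuous (fun x => `|x| `^ a)}.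
Proof.
move=> a0; apply/cvgrPdist_lt => e e0; near=> x.
rewrite normr0 powR0 ?gt_eqF// sub0r normrN ger0_norm ?powR_ge0//.
rewrite -[ltRHS](powRr1 (ltW e0)) -(mulVf (lt0r_neq0 a0)) powRrM.
apply: gt0_ltr_powR => //; rewrite ?nnegrE ?powR_ge0//.
rewrite -[x]subr0 distrC; near: x.
have e' : 0 < e `^ a^-1 by exact: powR_gt0.
by apply/nbhs_ballP; exists (e `^ a^-1).
Unshelve. all: by end_near. Qed.

Lemma cvg_spow0 p : 1 < p -> {for 0, continuous (spow p : R -> R)}.
Proof.
move=> p1; have := @cvg_powR_norm0 (p - 1) ltac:(lra).
move=> /cvgrPdist_lt h; apply/cvgrPdist_lt => e /h; apply: filterS => x.
rewrite normr0 powR0; last lra.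
rewrite !sub0r !normrN spow0 sub0r normrN.
rewrite [`|spow p x|](_ : _ = `|x| `^ (p - 1)); last first.
  by rewrite -(spow_ge0E p1)// /spow normrM normr_id [`|_ `^ _|]ger0_norm ?powR_ge0.
by rewrite ger0_norm// powR_ge0.
Qed.

(** For [p < 2] the graph has a vertical tangent at 0, hence the side condition. *)
Lemma is_derive_spow p x : 1 < p -> (x != 0) || (2 < p) ->
  is_derive x 1 (spow p) ((p - 1) * `|x| `^ (p - 2)).
Proof.
move=> p1; have [-> /=|xn0 _] := eqVneq x 0.
  move=> p2; rewrite normr0 powR0; last lra.
  have := is_derive_mulx (@cvg_powR_norm0 (p - 2) ltac:(lra)).
  by rewrite mulr0 normr0 powR0//; lra.
have pE : p - 1 - 1 = p - 2 by ring.
have [x0|x0] := ltP 0 x.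
  rewrite gtr0_norm// -pE.
  apply: (@near_eq_is_derive _ _ _ (fun x => x `^ (p - 1))).
    by near=> z; rewrite spow_ge0E// ltW//; near: z; exact: lt_nbhsr.
  exact: is_derive1_powR.
have {}x0 : x < 0 by rewrite lt_neqAle xn0.
rewrite ltr0_norm// -pE.
apply: (@near_eq_is_derive _ _ _ (fun x => - (- x) `^ (p - 1))).
  by near=> z; rewrite spow_le0E// ltW//; near: z; exact: lt_nbhsl.
have x0' : 0 < - x by rewrite oppr_gt0.
have d1 := @is_derive1_powR R (p - 1) _ x0'.
have d2 : is_derive x 1 (-%R : R -> R) (- 1) := is_deriveNid x 1.
have := is_deriveN (is_derive1_comp d1 d2).
by rewrite mulrN1 opprK.
Unshelve. all: by end_near. Qed.

Lemma is_derive_norm_powR p x : 1 < p ->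
  is_derive x 1 (fun x => `|x| `^ p) (p * spow p x).
Proof.
move=> p1.
have -> : (fun x => `|x| `^ p) = (fun x : R => x * spow p x).
  by apply/funext => y; rewrite mul_spow.
have [->|xn0] := eqVneq x 0.
  have := is_derive_mulx (cvg_spow0 p1); rewrite spow0 mulr0; exact.
have d1 := @is_derive_spow p x p1 ltac:(by rewrite xn0).
have := is_deriveM (is_derive_id x 1) d1.
rewrite /GRing.scale/= mulr1 => h; apply: is_derive_eq.
by rewrite /spow; ring.
Qed.

Lemma continuous_norm_powR p : 1 < p -> continuous (fun x : R => `|x| `^ p).
Proof.
move=> p1 x; apply: differentiable_continuous; apply/derivable1_diffP.
by have [] := is_derive_norm_powR x p1.
Qed.

Lemma continuous_spow p : 1 < p -> continuous (spow p : R -> R).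
Proof.
move=> p1 x; have [->|xn0] := eqVneq x 0; first exact: cvg_spow0.
apply: differentiable_continuous; apply/derivable1_diffP.
by have [] := @is_derive_spow p x p1 ltac:(by rewrite xn0).
Qed.

Lemma global_min_derive (h D : R -> R) (s : R) :
  (forall u, h s <= h u) -> (forall u : R, is_derive u 1 h (D u)) -> D s = 0.
Proof.
move=> smin hD.
have dh u : u \in `](s - 1), (s + 1)[%R -> derivable h u 1.
  by move=> _; have [] := hD u.
have ss : s \in `](s - 1), (s + 1)[%R.
  by rewrite in_itv/= ltrDl ltrBlDr ltrDl ltr01.
have s11 : s - 1 <= s + 1 by rewrite lerD2l lerNl; lra.
have [_ dv] := derive1_at_min s11 dh ss (fun u _ => smin u).
by have [_] := hD s; rewrite dv.
Qed.

End Derivatives.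

(** * The one-step minimization and the dynamic programme *)

(** The expression minimized in G of the overview, extended to all real [s] so that 0 becomes an
    interior point. For [w > 0] a negative [s] costs more than [s = 0], so the minimum is
    unchanged. *)
Definition cost {R : realType} (p w s : R) : R := w * `|s| `^ p - spow p (s - 1).

Definition cost_argmin {R : realType} (p w : R) : R :=
  xget 0 [set s | forall u, cost p w s <= cost p w u].

Definition min_cost {R : realType} (p w : R) : R := cost p w (cost_argmin p w).

Section Cost.
Set Implicit Arguments.
Unset Strict Implicit.
Context {R : realType} {p : R} (hp : 1 < p).
Implicit Types (w s u : R).

Lemma cost0 w : cost p w 0 = 1.
Proof.
have p1 := hp; rewrite /cost normr0 powR0; last lra.
by rewrite mulr0 !sub0r spowN opprK spow_ge0E// powR1.
Qed.

Lemma cost_neg w s : 0 < w -> s < 0 -> 1 < cost p w s.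
Proof.
move=> w0 s0; have p1 := hp; rewrite /cost.
have : 0 < w * `|s| `^ p by rewrite mulr_gt0// powR_gt0// normr_gt0 lt_eqF.
have : spow p (s - 1) < spow p (-1) by apply: ltr_spow => //; lra.
by rewrite spowN [spow p 1]spow_ge0E// powR1; lra.
Qed.

Lemma cost_large w s : 0 < w -> 1 + 2 / w < s -> 1 < cost p w s.
Proof.
move=> w0 sw; have p1 := hp.
have iw : 0 < 2 / w by rewrite divr_gt0.
have s1 : 1 < s by lra.
have ws : 2 < w * s.
  by rewrite -(@ltr_pM2l _ w) // mulrDr mulrCA divff ?gt_eqF// in sw; lra.
have h1 : 1 < s `^ (p - 1).
  have := @gt0_ltr_powR R (p - 1) _ 1 s; rewrite powR1; apply => //; rewrite ?nnegrE; lra.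
have h2 : (s - 1) `^ (p - 1) <= s `^ (p - 1).
  by apply: ge0_ler_powR; rewrite ?nnegrE; lra.
rewrite /cost gtr0_norm; last lra.
rewrite spow_ge0E//; last lra.
rewrite -mulr_powRB1; [|lra|lra].
nra.
Qed.

Lemma continuous_cost w : continuous (cost p w).
Proof.
move=> s; apply: cvgB.
  by apply: cvgM; [exact: cvg_cst | exact: continuous_norm_powR].
apply: (@continuous_comp _ _ _ (fun s : R => s - 1) (spow p)).
  by apply: cvgB; [exact: cvg_id | exact: cvg_cst].
exact: continuous_spow.
Qed.

Lemma is_derive_cost w s : (s != 1) || (2 < p) ->
  is_derive s 1 (cost p w) (w * (p * spow p s) - (p - 1) * `|s - 1| `^ (p - 2)).
Proof.
move=> sp; have d1 := is_derive_norm_powR s hp.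
have sp' : (s - 1 != 0) || (2 < p) by rewrite subr_eq0.
have d2 := is_derive_spow hp sp'.
have d3 : is_derive s 1 (fun x : R => x - 1) 1.
  by have := is_deriveB (is_derive_id s 1) (is_derive_cst (1 : R) s 1); rewrite subr0.
have d4 := @is_derive1_comp _ _ (fun x : R => x - 1) _ _ _ d2 d3.
have := is_deriveB (is_deriveZ w d1) d4.
by rewrite mulr1.
Qed.

Lemma cost_has_min w : 0 < w -> exists s, forall u, cost p w s <= cost p w u.
Proof.
move=> w0; pose M := 1 + 2 / w.
have M0 : 0 < M by rewrite addr_gt0// divr_gt0.
have cf : {within `[0, M], continuous (cost p w)}.
  by apply: continuous_subspaceT; exact: continuous_cost.
have [s sM smin] := EVT_min (ltW M0) cf.
have s1 : cost p w s <= 1.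
  by rewrite -(cost0 w); apply: smin; rewrite in_itv/= lexx ltW.
exists s => u; have [u0|u0] := ltP u 0.
  by apply: le_trans s1 _; exact/ltW/cost_neg.
have [uM|uM] := leP u M; first by apply: smin; rewrite in_itv/= u0.
by apply: le_trans s1 _; exact/ltW/cost_large.
Qed.

Lemma minimizer_critical w s : 0 < w -> (forall u, cost p w s <= cost p w u) ->
  (s != 1) || (2 < p) -> w * (p * spow p s) = (p - 1) * `|s - 1| `^ (p - 2).
Proof.
move=> w0 smin sp.
(* An open interval around [s] on which [is_derive_cost] applies: it avoids 1 unless [s = 1], where
   [2 < p]. *)
have [a [b [sab nab]]] : exists a b : R, a < s < b /\
    (forall u, a < u < b -> (u != 1) || (2 < p)).
  have [s1|s1|s1] := ltgtP s 1.
  - exists (s - 1), 1; split; first lra.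
    by move=> u /andP[_ ?]; rewrite lt_eqF.
  - exists 1, (s + 1); split; first lra.
    by move=> u /andP[? _]; rewrite gt_eqF.
  exists 0, 2; split; first lra.
  by move: sp; rewrite s1 eqxx/= => p2 u _; rewrite p2 orbT.
have ab : a <= b by lra.
have dab t : t \in `]a, b[%R -> derivable (cost p w) t 1.
  by rewrite in_itv/= => /nab tn; have [] := is_derive_cost w tn.
have sab' : s \in `]a, b[%R by rewrite in_itv.
have [_ dv] := derive1_at_min ab dab sab' (fun t _ => smin t).
have [_] := is_derive_cost w sp; rewrite dv; lra.
Qed.

(** At [s = 1] and [p > 2] the first-order condition would read [w * p = 0]. For [p < 2], moving to
    [1 + e] gains [e]^ (p - 1)[, which is of larger order than the O(e) increase of]w * s [^ p]. *)
Lemma minimizer_neq1 w s : p != 2 -> 0 < w -> (forall u, cost p w s <= cost p w u) ->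
  s != 1.
Proof.
move=> pn2 w0 smin; have p1 := hp; apply/eqP => s1; subst s.
have [p2|p2] := ltP 2 p.
  have /(minimizer_critical w0 smin) : (1 != 1 :> R) || (2 < p) by rewrite p2 orbT.
  rewrite subrr normr0 powR0 ?spow_ge0E ?powR1//; nra.
have q0 : 0 < 2 - p by rewrite subr_gt0 lt_neqAle pn2 p2.
(* [e] is at most 1 and satisfies [8 * w * e <= e]^ (p - 1)[, whereas]w * s [^ p] grows by at most
   [4 * w * e] from 1 to [1 + e]. *)
pose c := Num.min 1 (8 * w)^-1; have c0 : 0 < c.
  by rewrite lt_min ltr01/= invr_gt0 mulr_gt0.
pose e := c `^ (2 - p)^-1; have e0 : 0 < e by exact: powR_gt0.
have e1 : e <= 1.
  have := @ge0_ler_powR R (2 - p)^-1 _ c 1; rewrite powR1; apply.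
  - by rewrite invr_ge0 ltW.
  - by rewrite nnegrE ltW.
  - by rewrite nnegrE.
  - by rewrite ge_min lexx.
have ew : w * e `^ (2 - p) <= 8^-1.
  rewrite /e -powRrM mulVf ?gt_eqF// powRr1; last exact: ltW.
  apply: (@le_trans _ _ (w * (8 * w)^-1)).
    by rewrite ler_pM2l// /c ge_min lexx orbT.
  by rewrite le_eqVlt; apply/orP; left; apply/eqP; field; lra.
have e1p : (1 + e) `^ (p - 1) <= 2.
  apply: (@le_trans _ _ (2 `^ (p - 1))).
    by apply: ge0_ler_powR; rewrite ?nnegrE; lra.
  by apply: ler1_powR; lra.
have := smin (1 + e).
rewrite /cost subrr spow0 subr0 normr1 powR1 mulr1.
rewrite (_ : 1 + e - 1 = e); last ring.
rewrite spow_ge0E//; last exact: ltW.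
rewrite gtr0_norm; last lra.
have := powR_tangent p1 ler01 (_ : 0 <= 1 + e); rewrite powR1 => /(_ ltac:(lra)).
have -> : e `^ (p - 1) = e / e `^ (2 - p).
  rewrite -{2}(powRr1 (ltW e0)) -powRB; last by rewrite (gt_eqF e0)/= implybT.
  by congr (_ `^ _); ring.
have E0 : 0 < e `^ (2 - p) by exact: powR_gt0.
have : 8 * w * e <= e / e `^ (2 - p).
  rewrite ler_pdivlMr//.
  have : 0 <= e * (1 - 8 * (w * e `^ (2 - p))) by apply: mulr_ge0; lra.
  lra.
set X := (1 + e) `^ p; set Y := (1 + e) `^ (p - 1); set Z := e / _.
have Y0 : 0 <= Y by exact: powR_ge0.
move=> hZ hX hw.
have : w * X <= w * (1 + p * Y * e) by rewrite ler_pM2l//; lra.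
have : p * Y <= 4 by rewrite -/Y in e1p; nra.
have : 0 < w * e by rewrite mulr_gt0.
nra.
Qed.

(** At 0 the first-order condition would read [0 = p - 1]. *)
Lemma minimizer_gt0 w s : 0 < w -> (forall u, cost p w s <= cost p w u) -> 0 < s.
Proof.
move=> w0 smin; have p1 := hp.
have s0 : 0 <= s.
  rewrite leNgt; apply/negP => /(cost_neg w0).
  by rewrite ltNge -(cost0 w) smin.
rewrite lt_neqAle s0 andbT eq_sym; apply/eqP => sz; subst s.
have /(minimizer_critical w0 smin) : (0 != 1 :> R) || (2 < p).
  by rewrite eq_sym oner_eq0.
rewrite sub0r normrN normr1 powR1 spow0; lra.
Qed.

Lemma minimizer_le w s : 0 < w -> (forall u, cost p w s <= cost p w u) ->
  s <= 1 + 2 / w.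
Proof.
move=> w0 smin; rewrite leNgt; apply/negP => /(cost_large w0).
by rewrite ltNge -(cost0 w) smin.
Qed.

Lemma cost_argminP w u : 0 < w -> cost p w (cost_argmin p w) <= cost p w u.
Proof.
move=> w0; have [s hs] := cost_has_min w0.
exact: (@xgetI _ _ [set s | forall u, cost p w s <= cost p w u] s hs u).
Qed.

End Cost.

(** The maximum of [(s - 1)]^ (p - 1) / s [^ p] over [s >= 1], reached at [s = p]; it is the weight
    at which [min_cost] vanishes. *)
Definition crit_weight {R : realType} (p : R) : R := (p - 1) `^ (p - 1) / p `^ p.

(** W_n of the overview, with the weight truncated below at [crit_weight]. This keeps weights
    positive and values nonnegative for every [x]. *)
Fixpoint value {R : realType} (p : R) (n : nat) (x : R) : R :=
  if n is m.+1 then min_cost p (Num.max (crit_weight p) (x * value p m x)) else 1.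

Section Value.
Set Implicit Arguments.
Unset Strict Implicit.
Context {R : realType} {p : R} (hp : 1 < p).
Implicit Types (w s u x y : R).

Local Notation wc := (crit_weight p).

Lemma crit_weight_gt0 : 0 < wc.
Proof. by have p1 := hp; rewrite divr_gt0// powR_gt0; lra. Qed.

Lemma min_cost_le w u : 0 < w -> min_cost p w <= cost p w u.
Proof. exact: cost_argminP. Qed.

Lemma cost_argmin_gt0 w : 0 < w -> 0 < cost_argmin p w.
Proof. by move=> w0; apply: (minimizer_gt0 hp w0) => u; exact: cost_argminP. Qed.

Lemma cost_weightB w w' s : 0 <= s ->
  cost p w' s = cost p w s + (w' - w) * s `^ p.
Proof. by move=> s0; rewrite /cost ger0_norm//; ring. Qed.

(** The minimizer for [w'] is positive, so its cost drops strictly when the weight is lowered to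
    [w]. *)
Lemma min_cost_mono w w' : 0 < w -> w < w' -> min_cost p w < min_cost p w'.
Proof.
move=> w0 ww; have w'0 : 0 < w' by exact: lt_trans ww.
have s0 := cost_argmin_gt0 w'0.
apply: le_lt_trans (min_cost_le (cost_argmin p w') w0) _.
rewrite [ltRHS](cost_weightB w _ (ltW s0)) ltrDl mulr_gt0 ?subr_gt0//.
exact: powR_gt0.
Qed.

(** Testing [s = p] gives one inequality; the other is weighted AM-GM for [(s - 1) / (p - 1)] and
    1. *)
Lemma min_cost_crit : min_cost p wc = 0.
Proof.
have p1 := hp; have w0 := crit_weight_gt0; apply/eqP; rewrite eq_le; apply/andP; split.
  apply: le_trans (min_cost_le p w0) _.
  rewrite /cost gtr0_norm; last lra.
  rewrite spow_ge0E//; last lra.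
  rewrite /crit_weight divfK ?subrr// gt_eqF// powR_gt0; lra.
rewrite /min_cost; set s := cost_argmin p wc.
have s0 : 0 < s by exact: cost_argmin_gt0.
rewrite /cost gtr0_norm// subr_ge0.
have [s1|s1] := leP s 1.
  apply: le_trans (mulr_ge0 (ltW w0) (powR_ge0 _ _)).
  by rewrite (spow_le0E hp); [rewrite oppr_le0 powR_ge0|lra].
rewrite spow_ge0E//; last lra.
have x0 : 0 <= (s - 1) / (p - 1) by apply: divr_ge0; lra.
have := powR_weighted_AMGM p1 x0 ler01.
have -> : ((p - 1) * ((s - 1) / (p - 1)) + 1) / p = s * p^-1.
  by field; apply/andP; split; lra.
rewrite mulr1 !powRM; try (rewrite ?invr_ge0; lra).
rewrite !powRV; try lra.
rewrite ler_pdivrMr; last by (apply: powR_gt0; lra).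
move=> h; apply: le_trans h _; rewrite le_eqVlt; apply/orP; left; apply/eqP.
by rewrite /crit_weight; ring.
Qed.

(** The minimizer for [w] is tested at [w']; by [minimizer_le] it is at most [1 + 2 / wc]. *)
Lemma min_cost_lip w w' : wc <= w -> w <= w' ->
  min_cost p w' <= min_cost p w + (w' - w) * (1 + 2 / wc) `^ p.
Proof.
move=> cw ww; have p1 := hp; have c0 := crit_weight_gt0.
have w0 : 0 < w by exact: lt_le_trans cw.
have w'0 : 0 < w' by exact: lt_le_trans ww.
have s0 := cost_argmin_gt0 w0.
apply: le_trans (min_cost_le (cost_argmin p w) w'0) _.
rewrite (cost_weightB w _ (ltW s0)) lerD2l ler_wpM2l ?subr_ge0//.
have i0 : 0 < 2 / wc by rewrite divr_gt0.
apply: ge0_ler_powR; rewrite ?nnegrE; [lra|exact: ltW|lra|].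
apply: le_trans (minimizer_le hp w0 (fun u => cost_argminP hp u w0)) _.
by rewrite lerD2l ler_pM2l// lef_pV2.
Qed.

Definition trunc_min_cost w := min_cost p (Num.max wc w).

Lemma trunc_min_cost_mono : {homo trunc_min_cost : x y / x <= y}.
Proof.
move=> x y xy; have c0 := crit_weight_gt0.
have : Num.max wc x <= Num.max wc y by rewrite ge_max !le_max lexx xy orbT.
rewrite le_eqVlt /trunc_min_cost => /predU1P[->//|h]; apply/ltW/min_cost_mono => //.
by rewrite lt_max c0.
Qed.

Lemma trunc_min_cost_ge0 w : 0 <= trunc_min_cost w.
Proof.
rewrite -min_cost_crit -[X in min_cost p X](maxxx wc).
have [h|h] := leP wc w; first exact: trunc_min_cost_mono.
by rewrite /trunc_min_cost (max_l (ltW h)) maxxx.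
Qed.

Lemma trunc_min_cost_lip x y :
  `|trunc_min_cost x - trunc_min_cost y| <= (1 + 2 / wc) `^ p * `|x - y|.
Proof.
wlog xy : x y / x <= y.
  by move=> h; case: (leP x y) => [/h//|/ltW/h]; rewrite distrC [`|y - x|]distrC.
rewrite ler0_norm; last by rewrite subr_le0; exact: trunc_min_cost_mono.
rewrite ler0_norm ?subr_le0// [- (x - y)]opprB [leLHS]opprB.
have c0 := crit_weight_gt0.
have mxy : Num.max wc x <= Num.max wc y by rewrite ge_max !le_max lexx xy orbT.
have cx : wc <= Num.max wc x by rewrite le_max lexx.
have := min_cost_lip cx mxy; rewrite -/(trunc_min_cost x) -/(trunc_min_cost y) => h.
rewrite lerBlDl; apply: le_trans h _; rewrite lerD2l mulrC.
apply: ler_wpM2l; first exact: powR_ge0.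
have [h1|/ltW h1] := leP x wc; have [h2|/ltW h2] := leP y wc; lra.
Qed.

Lemma continuous_trunc_min_cost : continuous trunc_min_cost.
Proof.
move=> x; pose L := (1 + 2 / wc) `^ p.
have c0 := crit_weight_gt0.
have L0 : 0 < L by apply: powR_gt0; rewrite addr_gt0// divr_gt0.
apply/cvgrPdist_lt => e e0; near=> y.
apply: le_lt_trans (trunc_min_cost_lip _ _) _.
rewrite -/L -ltr_pdivlMl// mulrC; near: y.
have e' : 0 < e / L by exact: divr_gt0.
by apply/nbhs_ballP; exists (e / L).
Unshelve. all: by end_near. Qed.

Lemma value_ge0 n x : 0 <= value p n x.
Proof. by case: n => [|n]; [exact: ler01|exact: trunc_min_cost_ge0]. Qed.

Lemma value_mono n x y : 0 <= x -> x <= y -> value p n x <= value p n y.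
Proof.
move=> x0 xy; elim: n => [|n IHn]; first by [].
apply: trunc_min_cost_mono; apply: ler_pM => //; exact: value_ge0.
Qed.

Lemma continuous_value n : continuous (value p n).
Proof.
elim: n => [|n IHn] x; first exact: cvg_cst.
apply: (@continuous_comp _ _ _ (fun x => x * value p n x) trunc_min_cost).
  by apply: cvgM; [exact: cvg_id|exact: IHn].
exact: continuous_trunc_min_cost.
Qed.

(** [x] is the power T^p of the threshold for [n] steps. By the intermediate value theorem the next
    threshold solves [y * value p n y = wc], where [value p n.+1] vanishes by [min_cost_crit]. The
    product in the second clause accommodates [n = 0], with threshold 0 and value 1. *)
Lemma value_threshold n : exists x, [/\ 0 <= x, x * value p n x = 0,
  forall y j, x <= y -> (j < n)%N -> wc <= y * value p j y &
  forall y, x < y -> 0 < value p n y].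
Proof.
have c0 := crit_weight_gt0.
elim: n => [|n [x [x0 xz xj xn]]].
  by exists 0; split => //; rewrite mul0r.
pose k y := y * value p n y.
have kmono y z : 0 <= y -> y <= z -> k y <= k z.
  by move=> y0 yz; apply: ler_pM => //; [exact: value_ge0|exact: value_mono].
have x1 : x < x + 1 by rewrite ltrDl.
have v0 := xn _ x1; set v := value p n (x + 1) in v0.
(* Large enough for [k X >= wc], since [value p n X >= v]. *)
pose X := x + 1 + wc / v.
have X1 : x + 1 <= X by rewrite lerDl divr_ge0// ltW.
have kX : wc <= k X.
  apply: (@le_trans _ _ (X * v)); last first.
    by rewrite ler_wpM2l ?value_mono//; lra.
  by rewrite /X mulrDl divfK ?gt_eqF// lerDr mulr_ge0// ?ltW//; lra.
have ck : {within `[x, X], continuous k}.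
  apply: continuous_subspaceT => y.
  by apply: cvgM; [exact: cvg_id|exact: continuous_value].
have xX : x <= X by lra.
have [|z] := IVT xX ck (v := wc).
  by rewrite {1}/k xz ge_min le_max kX (ltW c0) orbT.
rewrite in_itv/= => /andP[xz' _] kz.
have xltz : x < z.
  by rewrite lt_neqAle xz' andbT; apply/eqP => xzE; rewrite -xzE /k xz in kz; lra.
exists z; split.
- exact: le_trans xz'.
- by rewrite /= -/(k z) kz maxxx min_cost_crit mulr0.
- move=> y j zy; rewrite ltnS leq_eqVlt => /predU1P[->|jn].
    by rewrite -kz; apply: kmono => //; exact: le_trans xz'.
  by apply: xj => //; exact: le_trans zy.
move=> y zy; rewrite /= -/(k y).
have kzy : wc < k y.
  rewrite -kz; apply: (@lt_le_trans _ _ (y * value p n z)).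
    by rewrite ltr_pM2r// xn.
  rewrite ler_wpM2l//; first by lra.
  by apply: value_mono; [lra|exact: ltW].
rewrite max_r ?ltW// -min_cost_crit; exact: min_cost_mono.
Qed.

End Value.

(** * The upper bound for arbitrary polynomials *)

Section Modulus.
Set Implicit Arguments.
Unset Strict Implicit.
Context {R : realType}.
Implicit Types (z : R[i]).

Lemma modulus_ge0 z : 0 <= modulus z.
Proof. by case: z => x y; exact: sqrtr_ge0. Qed.

Lemma sqr_modulus z : modulus z ^+ 2 = complex.Re z ^+ 2 + complex.Im z ^+ 2.
Proof. by case: z => x y /=; rewrite sqr_sqrtr// addr_ge0// sqr_ge0. Qed.

Lemma modulusM z1 z2 : modulus (z1 * z2) = modulus z1 * modulus z2.
Proof. exact: ComplexField.Normc.normcM. Qed.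

Lemma modulusN z : modulus (- z) = modulus z.
Proof. exact: normcN. Qed.

Lemma modulus_eq0 z : (modulus z == 0) = (z == 0).
Proof.
apply/eqP/eqP => [/ComplexField.Normc.eq0_normc//|->].
exact: ComplexField.Normc.normc0.
Qed.

Lemma modulus_real (x : R) : modulus x%:C = `|x|.
Proof. by rewrite /modulus/= expr0n/= addr0 sqrtr_sqr. Qed.

Lemma Re_le_modulus z : - modulus z <= complex.Re z <= modulus z.
Proof.
have h : `|complex.Re z| <= modulus z.
  rewrite -(@ler_pXn2r _ 2) ?nnegrE ?modulus_ge0// sqr_modulus.
  by rewrite real_normK ?num_real// lerDl sqr_ge0.
by rewrite -ler_norml.
Qed.

End Modulus.

(** * Comparison of the norms at two parameters on the same ray *)

Section Comparison.
Set Implicit Arguments.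
Unset Strict Implicit.
Context {R : realType} {p : R} (hp : 1 < p).

(** With [s = |u|], [m = |u - e|] and [y = Re u], this is the tangent inequality for [|u|^p] at u.
    The bound [s ^+ 2 - e * y <= m * s] is Cauchy-Schwarz. *)
Lemma planar_tangent (s m y e : R) : 0 <= s -> 0 <= m -> - s <= y <= s ->
  m ^+ 2 = s ^+ 2 - 2 * e * y + e ^+ 2 ->
  s `^ p - p * e * (s `^ (p - 2) * y) <= m `^ p.
Proof.
move=> s0 m0 ys mE; have p1 := hp.
have [sz|sn0] := eqVneq s 0.
  have -> : y = 0 by lra.
  by rewrite sz powR0 ?gt_eqF//; [rewrite !mulr0 subr0 powR_ge0|lra].
have sgt0 : 0 < s by rewrite lt0r sn0 s0.
apply: le_trans (powR_tangent p1 m0 s0).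
rewrite -(spow_ge0E hp s0) /spow ger0_norm//.
have : s ^+ 2 - e * y <= m * s.
  have [h|h] := leP (s ^+ 2 - e * y) 0; first exact: le_trans (mulr_ge0 m0 s0).
  rewrite -(@ler_pXn2r _ 2) ?nnegrE ?mulr_ge0//; last exact: ltW.
  rewrite exprMn mE; have : 0 <= e ^+ 2 * ((s - y) * (s + y)).
    by rewrite mulr_ge0 ?sqr_ge0// mulr_ge0//; lra.
  lra.
have E0 : 0 <= p * s `^ (p - 2) by rewrite mulr_ge0 ?powR_ge0//; lra.
move=> /(ler_wpM2l E0) h.
have -> : p * (s * s `^ (p - 2)) * (m - s)
  = p * s `^ (p - 2) * (m * s) - p * s `^ (p - 2) * s ^+ 2 by ring.
lra.
Qed.

Lemma unit_comparison (w g e : R) (z : R[i]) : 0 <= g -> 0 <= e ->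
  (forall s, 0 <= s -> spow p (s - 1) <= w * s `^ p - g) ->
  modulus (z - 1) `^ p - p * e * (w * modulus z `^ p - g)
  <= modulus (z - 1 - e%:C) `^ p.
Proof.
move=> g0 e0 wg; have p1 := hp.
set s := modulus (z - 1); pose y := complex.Re (z - 1).
have ys : - s <= y <= s := Re_le_modulus (z - 1).
have rE : modulus z ^+ 2 = s ^+ 2 + 2 * y + 1.
  by rewrite /s /y !sqr_modulus; case: (z) => a b /=; ring.
have mE : modulus (z - 1 - e%:C) ^+ 2 = s ^+ 2 - 2 * e * y + e ^+ 2.
  by rewrite /s /y !sqr_modulus; case: (z) => a b /=; ring.
have s0 : 0 <= s := modulus_ge0 _.
apply: le_trans (planar_tangent s0 (modulus_ge0 _) ys mE).
rewrite lerD2l lerN2; apply: ler_wpM2l; first by (rewrite mulr_ge0//; lra).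
exact: (planar_bound hp g0 wg (modulus_ge0 _) s0 ys rE).
Qed.

(** Division by [S%:C * o * b] reduces to [unit_comparison] with [e = (T - S) / S]. The loss in
    [modulus a] and the gain in [modulus b] are arranged to cancel along consecutive
    coefficients. *)
Lemma two_term_comparison (w g S T : R) (o a b : R[i]) : 0 <= g -> 0 < S -> S <= T ->
  modulus o = 1 ->
  (forall s, 0 <= s -> spow p (s - 1) <= S `^ p * w * s `^ p - g) ->
  modulus (a - S%:C * o * b) `^ p
    - p * (T - S) * S `^ (p - 1) * (w * modulus a `^ p - g * modulus b `^ p)
  <= modulus (a - T%:C * o * b) `^ p.
Proof.
move=> g0 S0 ST o1 wg; have p1 := hp.
have Sp0 : 0 < S `^ p := powR_gt0 _ S0.
have w0 : 0 <= w.
  have := wg _ ler01; rewrite subrr spow0 powR1 mulr1 => h.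
  by rewrite -(pmulr_rge0 _ Sp0); lra.
have c0 : 0 <= p * (T - S) * S `^ (p - 1).
  by rewrite !mulr_ge0 ?powR_ge0//; lra.
have [->|bn0] := eqVneq b 0.
  rewrite !mulr0 subr0 (_ : modulus 0 = 0) ?powR0; last first.
  - by apply/eqP; rewrite modulus_eq0.
  - by rewrite gt_eqF//; lra.
  rewrite gerBl mulr0 subr0; apply: mulr_ge0 => //.
  by rewrite mulr_ge0 ?powR_ge0.
have on0 : o != 0 by rewrite -modulus_eq0 o1 oner_eq0.
have SCn0 : S%:C != 0 by rewrite -modulus_eq0 modulus_real gtr0_norm// gt_eqF.
pose c := S%:C * o * b; pose z := a / c; pose e := (T - S) / S.
have cn0 : c != 0 by rewrite !mulf_neq0.
have aE : a = c * z by rewrite /z mulrC divfK.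
have cM : modulus c = S * modulus b.
  by rewrite /c !modulusM o1 mulr1 modulus_real gtr0_norm.
have -> : a - S%:C * o * b = c * (z - 1) by rewrite mulrBr mulr1 -aE.
have -> : a - T%:C * o * b = c * (z - 1 - e%:C).
  rewrite !mulrBr mulr1 -aE /c -addrA; congr (_ + _).
  have -> : T = S + S * e by rewrite /e mulrC divfK ?gt_eqF//; ring.
  rewrite rmorphD rmorphM; ring.
have -> : modulus a = S * modulus b * modulus z by rewrite {1}aE modulusM cM.
rewrite !(modulusM c) cM.
have b0 := modulus_ge0 b; have Sb0 : 0 <= S * modulus b by rewrite mulr_ge0// ltW.
rewrite !(powRM _ Sb0) ?modulus_ge0//.
have e0 : 0 <= e by rewrite divr_ge0; lra.
have := unit_comparison z g0 e0 wg.
have X0 : 0 <= (S * modulus b) `^ p := powR_ge0 _ _.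
move=> /(ler_wpM2l X0); apply: le_trans.
rewrite (powRM _ (ltW S0) b0) -(mulr_powRB1 (ltW S0)); last lra.
have -> : T - S = e * S by rewrite /e divfK// gt_eqF.
rewrite le_eqVlt; apply/orP; left; apply/eqP; ring.
Qed.

Lemma value_step (n : nat) (x : R) : crit_weight p <= x * value p n x ->
  forall s, 0 <= s -> spow p (s - 1) <= x * value p n x * s `^ p - value p n.+1 x.
Proof.
move=> cx s s0; have c0 := crit_weight_gt0 hp.
have w0 : 0 < x * value p n x by exact: lt_le_trans cx.
have := min_cost_le hp s w0; rewrite /cost ger0_norm//= max_r//; lra.
Qed.

Local Notation wc := (crit_weight p).

(** Induction along the shifted sequence: the tail supplies the multiple of [modulus (a 1)]^
    p[that]two_term_comparison[loses. The base case is the tangent inequality for]T [^ p] at [S]. *)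
Lemma telescoped_comparison (n : nat) (S T : R) (o : R[i]) (a : nat -> R[i]) :
  0 < S -> S <= T -> modulus o = 1 -> a n.+1 = 0 ->
  (forall j, (j < n)%N -> wc <= S `^ p * value p j (S `^ p)) ->
  p * (T - S) * S `^ (p - 1) * (value p n (S `^ p) * modulus (a 0%N) `^ p) <=
  \sum_(k < n.+1) (modulus (a k.+1 - T%:C * o * a k) `^ p
                   - modulus (a k.+1 - S%:C * o * a k) `^ p).
Proof.
move=> S0 ST o1; have p1 := hp; have T0 : 0 <= T by lra.
elim: n a => [|n IHn] a an wj.
  rewrite big_ord_recl big_ord0 addr0 /= an !sub0r mul1r.
  rewrite !modulusN !modulusM !modulus_real !ger0_norm ?(ltW S0)//.
  rewrite o1 !mulr1 !powRM ?modulus_ge0 ?(ltW S0)// -mulrBl.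
  apply: ler_wpM2r; first exact: powR_ge0.
  have := powR_tangent p1 T0 (ltW S0); lra.
rewrite big_ord_recl /=.
have := IHn (a \o succn) an (fun j jn => wj j (ltnW jn)).
have := two_term_comparison (a 1%N) (a 0%N) (value_ge0 hp n.+1 (S `^ p)) S0 ST o1
  (value_step (wj n (ltnSn n))).
rewrite /=; set A := _ * _ * _ `^ (p - 1); lra.
Qed.

(** Leading zeros are stripped until the bound of [telescoped_comparison] is positive; the values
    stay positive because the weights are at least [wc]. *)
Lemma strict_comparison (n : nat) (S T : R) (o : R[i]) (a : nat -> R[i]) :
  0 < S -> S < T -> modulus o = 1 -> a n.+1 = 0 ->
  (exists2 k, (k <= n)%N & a k != 0) ->
  (forall j, (j < n)%N -> wc <= S `^ p * value p j (S `^ p)) ->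
  0 < value p n (S `^ p) ->
  0 < \sum_(k < n.+1) (modulus (a k.+1 - T%:C * o * a k) `^ p
                   - modulus (a k.+1 - S%:C * o * a k) `^ p).
Proof.
move=> S0 ST o1; have p1 := hp; have c0 := crit_weight_gt0 hp.
have Sp0 : 0 < S `^ p := powR_gt0 _ S0.
have pos m (c : R[i]) : c != 0 -> 0 < value p m (S `^ p) ->
    0 < p * (T - S) * S `^ (p - 1) * (value p m (S `^ p) * modulus c `^ p).
  move=> cn0 vm.
  have mc0 : 0 < modulus c by rewrite lt0r modulus_eq0 cn0 modulus_ge0.
  apply: mulr_gt0; last by apply: mulr_gt0 => //; exact: powR_gt0.
  by apply: mulr_gt0; [apply: mulr_gt0; lra|exact: powR_gt0].
elim: n a => [|n IHn] a an [k kn ak] wj vn.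
all: have [a0|a0] := eqVneq (a 0%N) 0; last first.
1,3: apply: lt_le_trans (telescoped_comparison S0 (ltW ST) o1 an wj).
1,2: exact: pos.
  by move: kn ak; rewrite leqn0 => /eqP ->; rewrite a0 eqxx.
rewrite big_ord_recl /= a0 !mulr0 subr0 subrr add0r.
apply: (IHn (a \o succn)) => //.
- case: k kn ak => [|k] kn ak; first by rewrite a0 eqxx in ak.
  by exists k.
- by move=> j jn; apply: wj; exact: ltnW.
- by rewrite -(pmulr_rgt0 _ Sp0); apply: lt_le_trans (wj n (ltnSn n)).
Qed.

End Comparison.

(** * Norms of polynomials as finite sums *)

Definition psum {R : realType} (p : R) (n : nat) (u : nat -> R[i]) : R :=
  \sum_(k < n) modulus (u k) `^ p.

Section Norm.
Set Implicit Arguments.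
Unset Strict Implicit.
Context {R : realType} {p : R} (hp : 1 < p).
Implicit Types (u v : nat -> R[i]).

Lemma psum_ge0 n u : 0 <= psum p n u.
Proof. by apply: sumr_ge0 => k _; exact: powR_ge0. Qed.

Lemma lpnorm_psum n u : (forall k, (n <= k)%N -> u k = 0) ->
  lpnorm p u = ((psum p n u) `^ p^-1)%:E.
Proof.
move=> u0; have p1 := hp; rewrite /lpnorm.
rewrite (nneseries_split 0 n); last by move=> k _; rewrite lee_fin powR_ge0.
rewrite add0n [X in (_ + X)%E]eseries0 ?adde0; last first.
  move=> k nk _; rewrite u0// (_ : modulus 0 = 0) ?powR0//; last first.
  - by apply/eqP; rewrite modulus_eq0.
  - by rewrite gt_eqF//; lra.
by rewrite sumEFin poweR_EFin big_mkord.
Qed.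

Lemma lpnorm_le n u v : (forall k, (n <= k)%N -> u k = 0) ->
  (forall k, (n <= k)%N -> v k = 0) ->
  (lpnorm p u <= lpnorm p v)%E = (psum p n u <= psum p n v).
Proof.
move=> u0 v0; have p1 := hp; rewrite (lpnorm_psum u0) (lpnorm_psum v0) lee_fin.
have ip : 0 < p^-1 by rewrite invr_gt0; lra.
have [h|h] := leP (psum p n u) (psum p n v).
  by apply: ge0_ler_powR; rewrite ?nnegrE ?psum_ge0// ltW.
apply/negbTE; rewrite -ltNge.
by apply: gt0_ltr_powR => //; rewrite nnegrE psum_ge0.
Qed.

Lemma mul_1subtz_coefs_eq0 n (f : {poly R[i]}) (s : R[i]) :
  (size f <= n)%N -> forall k, (n < k)%N -> mul_1subtz s (coefs f) k = 0.
Proof.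
move=> fn [//|k] nk; rewrite /mul_1subtz /coefs/= !nth_default ?mulr0 ?subr0//.
  exact: leq_trans fn _.
by apply: leq_trans fn _; exact: ltnW.
Qed.

Lemma psum_mul_1subtz n (a : nat -> R[i]) (s : R[i]) :
  psum p n.+2 (mul_1subtz s a) =
  modulus (a 0%N) `^ p + \sum_(k < n.+1) modulus (a k.+1 - s * a k) `^ p.
Proof. by rewrite /psum big_ord_recl /mul_1subtz/= mulr0 subr0. Qed.

Lemma is_minimizerE n (f : {poly R[i]}) (t : R[i]) : (size f <= n.+1)%N ->
  is_minimizer p (coefs f) t <->
  forall s, psum p n.+2 (mul_1subtz t (coefs f)) <= psum p n.+2 (mul_1subtz s (coefs f)).
Proof.
move=> fn; split=> h s; move: (h s);
  by rewrite (@lpnorm_le n.+2) => //; exact: mul_1subtz_coefs_eq0.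
Qed.

Lemma hfun_psum n (q : {poly R}) (s : R) : (size q <= n.+1)%N ->
  hfun p (map_poly (real_complex R) q) s =
  psum p n.+2 (mul_1subtz s%:C (coefs (map_poly (real_complex R) q))).
Proof.
move=> qn; have p1 := hp; rewrite /hfun.
rewrite (@lpnorm_psum n.+2); last first.
  by apply: mul_1subtz_coefs_eq0; rewrite size_map_poly.
rewrite fine_poweR/= -powRrM mulVf ?gt_eqF ?powRr1 ?psum_ge0//; lra.
Qed.

Lemma hfunE n (q : {poly R}) : (size q <= n.+1)%N ->
  hfun p (map_poly (real_complex R) q) =
  fun s => \sum_(k < n.+2) `|coefs q k - s * prevcoef (coefs q) k| `^ p.
Proof.
move=> qn; apply/funext => s; rewrite (hfun_psum s qn).
apply: eq_bigr => k _; congr (_ `^ _).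
rewrite -modulus_real; congr modulus.
case: (nat_of_ord k) => [|j]; rewrite /mul_1subtz /coefs/= !coef_map/=.
  by rewrite !mulr0 !subr0.
by rewrite rmorphB rmorphM.
Qed.

Lemma minimizer_modulus_le n (f : {poly R[i]}) (x : R) (tau : R[i]) :
  0 <= x -> (forall y j, x <= y -> (j < n)%N -> crit_weight p <= y * value p j y) ->
  (forall y, x < y -> 0 < value p n y) ->
  (size f <= n.+1)%N -> f != 0 -> is_minimizer p (coefs f) tau ->
  modulus tau <= x `^ p^-1.
Proof.
move=> x0 wx vx fn f0 /(is_minimizerE _ fn) tmin; have p1 := hp.
rewrite leNgt; apply/negP; set t := x `^ p^-1; set T := modulus tau => tT.
have t0 : 0 <= t := powR_ge0 _ _.
pose S := (t + T) / 2; have S0 : 0 < S by rewrite /S; lra.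
have ST : S < T by rewrite /S; lra.
have tS : t < S by rewrite /S; lra.
have xS : x < S `^ p.
  have -> : x = t `^ p.
    by rewrite /t -powRrM mulVf ?powRr1//; rewrite gt_eqF//; lra.
  by apply: gt0_ltr_powR => //; rewrite ?nnegrE; lra.
pose o := tau / T%:C.
have TCn0 : T%:C != 0 by rewrite -modulus_eq0 modulus_real gtr0_norm ?gt_eqF//; lra.
have o1 : modulus o = 1.
  have : modulus (T%:C * o) = T by rewrite /o mulrC divfK.
  rewrite modulusM modulus_real gtr0_norm; last lra.
  by move=> h; apply: (@mulfI _ T); rewrite ?mulr1// gt_eqF//; lra.
have fS : coefs f n.+1 = 0 by rewrite /coefs nth_default.
have fk : exists2 k, (k <= n)%N & coefs f k != 0.
  exists (size f).-1; last by rewrite /coefs -lead_coefE lead_coef_eq0.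
  by rewrite -ltnS prednK// lt0n size_poly_eq0.
have := strict_comparison hp S0 ST o1 fS fk (fun j jn => wx _ j (ltW xS) jn) (vx _ xS).
have -> : T%:C * o = tau by rewrite /o mulrC divfK.
rewrite sumrB subr_gt0 => h.
have := tmin (S%:C * o); rewrite !psum_mul_1subtz lerD2l leNgt => /negP; apply.
exact: h.
Qed.

End Norm.

(** * The extremal polynomial *)

(** J(f, s) of the overview for real coefficients, that is, [- p^-1] times the derivative of the sum
    of [p]-th powers. *)
Definition slope {R : realType} (p : R) (n : nat) (a : nat -> R) (s : R) : R :=
  \sum_(k < n) spow p (a k - s * prevcoef a k) * prevcoef a k.

Section RealSum.
Set Implicit Arguments.
Unset Strict Implicit.
Context {R : realType} {p : R} (hp : 1 < p).
Variables (n : nat) (a : nat -> R).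
Implicit Types (s t : R).

Local Notation H := (fun s : R => \sum_(k < n) `|a k - s * prevcoef a k| `^ p).

Lemma norm_powR_tangent (x y : R) : `|x| `^ p + p * spow p x * (y - x) <= `|y| `^ p.
Proof.
have p1 := hp; have p0 : 0 <= p by lra.
apply: le_trans (powR_tangent p1 (normr_ge0 y) (normr_ge0 x)).
have h1 : spow p x * y <= `|x| `^ (p - 1) * `|y|.
  apply: le_trans (ler_norm _) _.
  rewrite normrM -(spow_ge0E p1)// /spow !normrM normr_id.
  by rewrite [`|_ `^ _|]ger0_norm ?powR_ge0.
have h2 : spow p x * x = `|x| `^ (p - 1) * `|x|.
  by rewrite mulrC (mul_spow p1) mulrC mulr_powRB1//; lra.
have := ler_wpM2l p0 h1.
have := congr1 ( *%R p) h2; set Q := spow p x; lra.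
Qed.

Lemma sum_tangent s t : H t - p * (s - t) * slope p n a t <= H s.
Proof.
rewrite /slope mulr_sumr -sumrB; apply: ler_sum => k _.
apply: le_trans (norm_powR_tangent (a k - t * prevcoef a k) _).
rewrite lerD2l le_eqVlt; apply/orP; left; apply/eqP; ring.
Qed.

Lemma is_derive_sum_norm s : is_derive s 1 H (- p * slope p n a s).
Proof.
have -> : H = \sum_(k < n) (fun s : R => `|a k - s * prevcoef a k| `^ p).
  by apply/funext => u; rewrite fct_sumE.
have dk (k : 'I_n) : is_derive s 1 (fun s : R => `|a k - s * prevcoef a k| `^ p)
    (p * spow p (a k - s * prevcoef a k) * - prevcoef a k).
  have d1 := is_derive_norm_powR (a k - s * prevcoef a k) hp.
  have d2 : is_derive s 1 (fun s : R => a k - s * prevcoef a k) (- prevcoef a k).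
    have d3 := is_deriveM (is_derive_id s 1) (is_derive_cst (prevcoef a k) s 1).
    have := is_deriveB (is_derive_cst (a k) s 1) d3.
    by rewrite /GRing.scale/= !mulr0 mulr1 !add0r.
  exact: (@is_derive1_comp _ _ (fun s : R => a k - s * prevcoef a k) _ _ _ d1 d2).
have := is_derive_sum dk.
have -> // : \sum_(k < n) p * spow p (a k - s * prevcoef a k) * - prevcoef a k
   = - p * slope p n a s.
by rewrite /slope mulr_sumr; apply: eq_bigr => k _; ring.
Qed.

(** Every term is nonincreasing in the parameter, and the term of index [j.+1] is strictly
    decreasing. *)
Lemma slope_inj s t (j : nat) : (j.+1 < n)%N -> a j != 0 -> slope p n a s = slope p n a t -> s = t.
Proof.
wlog st : s t / s < t.
  by move=> h jn aj e; have [st|st|//] := ltgtP s t; [exact: h|apply/esym/h].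
move=> jn aj e; exfalso; move: e; apply/eqP; rewrite gt_eqF// -subr_gt0 -sumrB.
have term_ge0 (k : 'I_n) : 0 <= spow p (a k - s * prevcoef a k) * prevcoef a k
    - spow p (a k - t * prevcoef a k) * prevcoef a k.
  rewrite -mulrBl; set c := prevcoef a k.
  have [c0|c0] := leP 0 c.
    rewrite mulr_ge0// subr_ge0; apply: (ler_spow hp); nra.
  rewrite -mulrNN mulr_ge0; do ?lra.
  rewrite oppr_ge0 subr_le0; apply: (ler_spow hp); nra.
rewrite (bigD1 (Ordinal jn))//=.
apply: ltr_pwDl; last by apply: sumr_ge0.
rewrite -mulrBl; have [c0|c0] := leP 0 (a j).
  have {}c0 : 0 < a j by rewrite lt0r aj.
  rewrite mulr_gt0// subr_gt0; apply: (ltr_spow hp); nra.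
rewrite -mulrNN mulr_gt0; do ?lra.
rewrite oppr_gt0 subr_lt0; apply: (ltr_spow hp); nra.
Qed.

(* Multiplying the k-th relation by [a k] and summing, the index shift in the
   right-hand side leaves [p] times the slope. *)
Lemma slope_eq0 m t : n = m.+2 -> a m.+1 = 0 ->
  (forall k : nat, (k <= m)%N ->
     (p * a k * t - a k.+1) * (`|a k.+1 - t * a k| `^ (p - 2)) =
     (p - 1) * prevcoef a k * (`|a k - t * prevcoef a k| `^ (p - 2))) ->
  slope p n a t = 0.
Proof.
move=> nm am rec; have p1 := hp.
pose b k := (p - 1) * (a k * a k.+1 * `|a k.+1 - t * a k| `^ (p - 2)).
have step k : (k <= m)%N -> - p * (spow p (a k.+1 - t * a k) * a k)
    = (if k is j.+1 then b j else 0) - b k.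
  move=> km; have := rec k km; rewrite /spow /b => e.
  transitivity ((p * a k * t - a k.+1) * `|a k.+1 - t * a k| `^ (p - 2) * a k
      - (p - 1) * (a k * a k.+1 * `|a k.+1 - t * a k| `^ (p - 2))); first by ring.
  rewrite e; congr (_ - _); case: (k) => [|j] /=; first by rewrite !mulr0 !mul0r.
  by ring.
have sl : - p * slope p n a t = \sum_(k < m.+1) ((if nat_of_ord k is j.+1 then b j else 0) - b k).
  rewrite /slope nm big_ord_recl /= mulr0 add0r mulr_sumr.
  by apply: eq_bigr => k _; rewrite -step// -ltnS.
have : - p * slope p n a t = 0.
  rewrite sl sumrB big_ord_recl big_ord_recr /= add0r.
  have -> : b m = 0 by rewrite /b am mulr0 mul0r mulr0.
  by rewrite addr0 subrr.
by move/eqP; rewrite mulf_eq0 oppr_eq0 gt_eqF ?orFb; [move/eqP|lra].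
Qed.

End RealSum.

(* [x] stands for [t ^ p]. *)
Fixpoint extremal_coef {R : realType} (p : R) (d : nat) (x : R) (k : nat) : R :=
  if k is j.+1 then
    x `^ p^-1 * cost_argmin p (x * value p (d - j.+1) x) * extremal_coef p d x j
  else 1.

Definition extremal_poly {R : realType} (p : R) (d : nat) (x : R) : {poly R} :=
  \poly_(k < d.+1) extremal_coef p d x k.

Section Extremal.
Set Implicit Arguments.
Unset Strict Implicit.
Context {R : realType} {p : R} (hp : 1 < p) (hp2 : p != 2).
Context {d : nat} {x : R}.
Hypothesis x0 : 0 < x.
Hypothesis xv : forall j, (j < d)%N -> crit_weight p <= x * value p j x.
Hypothesis xd : value p d x = 0.

Local Notation t := (x `^ p^-1).
Local Notation a := (coefs (extremal_poly p d x)).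
Local Notation weight k := (x * value p (d - k.+1) x).
Local Notation ratio k := (cost_argmin p (weight k)).

Lemma extremal_t_gt0 : 0 < t. Proof. exact: powR_gt0. Qed.

Lemma extremal_tp : t `^ p = x.
Proof.
by have p1 := hp; rewrite -powRrM mulVf ?powRr1 ?(ltW x0)// gt_eqF//; lra.
Qed.

Lemma weight_gt0 k : (k < d)%N -> 0 < weight k.
Proof.
move=> kd; apply: lt_le_trans (crit_weight_gt0 hp) (xv _).
by rewrite ltn_subrL (leq_ltn_trans (leq0n k) kd).
Qed.

Lemma extremal_ratio_gt0 k : (k < d)%N -> 0 < ratio k.
Proof. by move=> kd; apply: (cost_argmin_gt0 hp); exact: weight_gt0. Qed.

Lemma extremal_step k : (k < d)%N -> a k.+1 = t * ratio k * a k.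
Proof. by move=> kd; rewrite /coefs !coef_poly !ltnS kd ltnW. Qed.

Lemma extremal0 : a 0%N = 1. Proof. by rewrite /coefs coef_poly. Qed.

Lemma extremal_gt0 k : (k <= d)%N -> 0 < a k.
Proof.
elim: k => [_|k IHk kd]; first by rewrite extremal0.
rewrite extremal_step// mulr_gt0 ?IHk 1?ltnW// mulr_gt0 ?extremal_t_gt0//.
exact: extremal_ratio_gt0.
Qed.

Lemma extremal_eq0 k : (d < k)%N -> a k = 0.
Proof. by move=> dk; rewrite /coefs coef_poly ltnS leqNgt dk. Qed.

Lemma extremal_critical k : (k < d)%N ->
  p * weight k * ratio k `^ (p - 1) = (p - 1) * `|ratio k - 1| `^ (p - 2).
Proof.
move=> kd; have w0 := weight_gt0 kd.
have rmin u := cost_argminP hp u w0.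
have := minimizer_critical hp w0 rmin.
rewrite (minimizer_neq1 hp hp2 w0 rmin) => /(_ isT) <-.
rewrite (spow_ge0E hp (ltW (extremal_ratio_gt0 kd))); ring.
Qed.

(** The first-order condition times the ratio eliminates the weight from the minimal cost. *)
Lemma extremal_value k : (k < d)%N ->
  p * value p (d - k) x = (p - ratio k) * `|ratio k - 1| `^ (p - 2).
Proof.
move=> kd; have p1 := hp; have r0 := extremal_ratio_gt0 kd.
have -> : (d - k = (d - k.+1).+1)%N by rewrite subnSK.
rewrite /= max_r; last by apply: xv; rewrite ltn_subrL (leq_ltn_trans (leq0n k) kd).
rewrite /min_cost /cost gtr0_norm// -(mulr_powRB1 (ltW r0)); last lra.
have := congr1 ( *%R (ratio k)) (extremal_critical kd).
rewrite /spow; lra.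
Qed.

(* Both sides of the recurrence equal [p * (t * a k) ^ (p - 1) * value (d - k)]. *)
Lemma extremal_left k : (k <= d)%N ->
  (p * a k * t - a k.+1) * `|a k.+1 - t * a k| `^ (p - 2) =
  (t * a k) `^ (p - 1) * (p * value p (d - k) x).
Proof.
move=> kd; have p1 := hp; have t0 := extremal_t_gt0; have a0 := extremal_gt0 kd.
have ta0 : 0 < t * a k by exact: mulr_gt0.
rewrite -(spow_ge0E hp (ltW ta0)) /spow (gtr0_norm ta0).
have [k_lt|] := ltnP k d; last first.
  (* At the last index [a d.+1 = 0] matches the terminal value [value p 0 x = 1]. *)
  move=> dk; have -> : k = d by apply/eqP; rewrite eqn_leq kd dk.
  have -> : a d.+1 = 0 by exact: extremal_eq0.
  have td0 : 0 < t * a d by rewrite mulr_gt0// extremal_gt0.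
  rewrite sub0r normrN (gtr0_norm td0) subnn /=; ring.
rewrite extremal_value// extremal_step//.
have -> : t * ratio k * a k - t * a k = t * a k * (ratio k - 1) by ring.
rewrite normrM (gtr0_norm ta0) (powRM _ (ltW ta0) (normr_ge0 _)); ring.
Qed.

Lemma extremal_right k : (k <= d)%N ->
  (p - 1) * prevcoef a k * `|a k - t * prevcoef a k| `^ (p - 2) =
  (t * a k) `^ (p - 1) * (p * value p (d - k) x).
Proof.
(* The threshold condition [value p d x = 0] is exactly the relation of index 0, where
   [prevcoef a 0 = 0]. *)
case: k => [|k] kd; first by rewrite subn0 xd /= !mulr0 mul0r.
have p1 := hp; have t0 := extremal_t_gt0; have a0 := extremal_gt0 (ltnW kd).
have r0 := extremal_ratio_gt0 kd.
have ta0 : 0 < t * a k by exact: mulr_gt0.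
rewrite /prevcoef extremal_step//.
have -> : t * ratio k * a k - t * a k = t * a k * (ratio k - 1) by ring.
rewrite normrM (gtr0_norm ta0) (powRM _ (ltW ta0) (normr_ge0 _)).
have -> : t * (t * ratio k * a k) = t * a k * (t * ratio k) by ring.
rewrite (powRM _ (ltW ta0)) ?mulr_ge0 ?(ltW t0) ?(ltW r0)//.
rewrite (powRM _ (ltW t0) (ltW r0)).
rewrite -(spow_ge0E hp (ltW ta0)) /spow (gtr0_norm ta0).
transitivity (a k * (t * a k) `^ (p - 2) * ((p - 1) * `|ratio k - 1| `^ (p - 2))).
  by ring.
rewrite -extremal_critical//.
have -> : weight k = t * t `^ (p - 1) * value p (d - k.+1) x.
  by rewrite mulr_powRB1 ?extremal_tp ?(ltW t0)//; lra.
ring.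
Qed.

(** Between the ends the difference is [t * a (k - 1)] times the ratio minus 1, nonzero by
    [minimizer_neq1]; at each end only one of its two terms survives. *)
Lemma extremal_neq0 k : (k <= d.+1)%N -> a k - t * prevcoef a k != 0.
Proof.
have t0 := extremal_t_gt0.
case: k => [_|k]; first by rewrite /= mulr0 subr0 extremal0 oner_eq0.
rewrite ltnS => kd; have a0 := extremal_gt0 kd; rewrite /prevcoef.
have [k_lt|dk] := ltnP k d; last first.
  by rewrite extremal_eq0 ?ltnS// sub0r oppr_eq0 mulf_neq0// gt_eqF.
rewrite extremal_step// (_ : _ - _ = t * a k * (ratio k - 1)); last by ring.
apply: mulf_neq0; first by rewrite mulf_neq0// gt_eqF.
rewrite subr_eq0; have w0 := weight_gt0 k_lt.
by apply: (minimizer_neq1 hp hp2 w0) => u; exact: cost_argminP.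
Qed.

Lemma extremal_slope : slope p d.+2 a t = 0.
Proof.
apply: (slope_eq0 hp (m := d)) => //; first exact: extremal_eq0.
by move=> k kd; rewrite extremal_left// extremal_right.
Qed.

Local Notation f := (map_poly (real_complex R) (extremal_poly p d x)).

Lemma size_extremal : (size (extremal_poly p d x) <= d.+1)%N.
Proof. exact: size_poly. Qed.

Lemma size_extremal_complex : (size f <= d.+1)%N.
Proof. by rewrite size_map_poly size_extremal. Qed.

Lemma slope_extremal_inj s : slope p d.+2 a s = 0 -> s = t.
Proof.
rewrite -extremal_slope; apply: (slope_inj hp (j := 0%N)) => //.
by rewrite extremal0 oner_eq0.
Qed.

Lemma is_derive_hfun_extremal (s : R) : is_derive s 1 (hfun p f) (- p * slope p d.+2 a s).
Proof. by rewrite (hfunE hp size_extremal); exact: is_derive_sum_norm. Qed.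

Lemma extremal_min s : hfun p f t <= hfun p f s.
Proof.
rewrite (hfunE hp size_extremal); have := sum_tangent hp d.+2 a s t.
by rewrite extremal_slope mulr0 subr0.
Qed.


Lemma slope_extremal_eq0 s : slope p d.+2 a s = 0 <-> s = t.
Proof.
by split=> [h|->]; [exact: slope_extremal_inj h|exact: extremal_slope].
Qed.

Lemma hfun_min_unique (s : R) : hfun p f s <= hfun p f t -> s = t.
Proof.
move=> st; apply: slope_extremal_inj.
have s_min u : hfun p f s <= hfun p f u by apply: le_trans st (extremal_min u).
have := global_min_derive s_min is_derive_hfun_extremal.
move=> /eqP; rewrite mulf_eq0 oppr_eq0 (gt_eqF (lt_trans ltr01 hp)) /=.
by move/eqP.
Qed.

Lemma Re_extremal_term (s : R[i]) k :
  complex.Re (mul_1subtz s (coefs f) k) = a k - complex.Re s * prevcoef a k.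
Proof.
case: s => u v; case: k => [|k]; rewrite /mul_1subtz /coefs/= !coef_map/=; ring.
Qed.

Lemma Im_extremal_term (s : R[i]) k :
  complex.Im (mul_1subtz s (coefs f) k) = - complex.Im s * prevcoef a k.
Proof.
case: s => u v; case: k => [|k]; rewrite /mul_1subtz /coefs/= !coef_map/=; ring.
Qed.

Lemma Re_term_le (s : R[i]) k :
  `|a k - complex.Re s * prevcoef a k| <= modulus (mul_1subtz s (coefs f) k).
Proof. by rewrite -Re_extremal_term ler_norml Re_le_modulus. Qed.

(** Since the coefficients are real, replacing [s] by its real part keeps the real part of each term
    and removes the imaginary part. *)
Lemma hfun_Re_le (s : R[i]) :
  hfun p f (complex.Re s) <= psum p d.+2 (mul_1subtz s (coefs f)).
Proof.
have p1 := hp; rewrite (hfunE hp size_extremal); apply: ler_sum => k _.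
by apply: ge0_ler_powR; rewrite ?nnegrE ?modulus_ge0 ?Re_term_le//; lra.
Qed.

Lemma hfun_Re_eq (s : R[i]) :
  psum p d.+2 (mul_1subtz s (coefs f)) <= hfun p f (complex.Re s) ->
  complex.Im s = 0.
Proof.
rewrite (hfunE hp size_extremal) => h; have p1 := hp; have p0 : 0 < p by lra.
have term_ge0 (k : 'I_d.+2) : 0 <= modulus (mul_1subtz s (coefs f) k) `^ p
    - `|a k - complex.Re s * prevcoef a k| `^ p.
  rewrite subr_ge0; apply: ge0_ler_powR; rewrite ?nnegrE ?modulus_ge0 ?Re_term_le//.
  exact: ltW.
have : \sum_(k < d.+2) (modulus (mul_1subtz s (coefs f) k) `^ p
    - `|a k - complex.Re s * prevcoef a k| `^ p) = 0.
  apply/eqP; rewrite eq_le sumr_ge0// andbT sumrB subr_le0; exact: h.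
(* Equality of the sums forces equality in every term; the term of index 1 has imaginary part
   [- Im s], as [a 0 = 1]. *)
move/psumr_eq0P => /(_ (fun k _ => term_ge0 k)) /(_ (Ordinal (isT : (1 < d.+2)%N)) isT).
move/subr0_eq => /= e.
have := powR_injective p0 (modulus_ge0 _) (normr_ge0 _) e.
move=> /(congr1 (fun z => z ^+ 2)).
rewrite sqr_modulus real_normK ?num_real// Re_extremal_term Im_extremal_term /=.
rewrite extremal0 => /(canRL (addKr _)); rewrite addNr mulr1.
by move/eqP; rewrite sqrf_eq0 oppr_eq0 => /eqP.
Qed.

Lemma extremal_tmin : tmin p (coefs f) = t%:C.
Proof.
apply: xget_unique.
  apply/(is_minimizerE hp _ size_extremal_complex) => s.
  rewrite -(hfun_psum hp _ size_extremal); apply: le_trans (hfun_Re_le s); exact: extremal_min.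
move=> s /(is_minimizerE hp _ size_extremal_complex) /(_ t%:C).
rewrite -(hfun_psum hp _ size_extremal) => st.
have sI : complex.Im s = 0.
  by apply: hfun_Re_eq; apply: le_trans st (extremal_min _).
have sR : complex.Re s = t.
  by apply: hfun_min_unique; apply: le_trans (hfun_Re_le s) st.
by case: (s) sI sR => u v /= -> ->.
Qed.

Lemma extremal_complex_neq0 : f != 0.
Proof.
rewrite map_poly_eq0; apply/eqP => q0; have := extremal0.
by rewrite /coefs q0 coef0 => /esym/eqP; rewrite oner_eq0.
Qed.

End Extremal.

Theorem theorem7p4 (R : realType) (p : R) (d : nat)
    (hp1 : 1 < p) (hp2 : p != 2) (hd : (2 < d)%N) :
  exists (q : {poly R}) (t : R),
    let f : {poly R[i]} := map_poly (real_complex R) q in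
    let a := coefs q in
    (* (a) *)
    [/\ f != 0 /\ (size f <= d.+1)%N,
        (forall k : nat, 0 <= a k),
        Tsup d p = t%:E /\ tmin p (coefs f) = t%:C,
        (* for p < 2 no power in the recurrence has base 0 *)
        (p < 2 -> forall k : nat, (k <= d.+1)%N -> a k - t * prevcoef a k != 0) &
        forall k : nat, (k <= d)%N ->
          (p * a k * t - a k.+1) * (`|a k.+1 - t * a k| `^ (p - 2)) =
          (p - 1) * prevcoef a k * (`|a k - t * prevcoef a k| `^ (p - 2))] /\
    (* (b) *)
    (forall s : R, derivable (hfun p f) s 1) /\
    (forall s : R, derive1 (hfun p f) s = 0 <-> s = t).
Proof.
have d0 : (0 < d)%N by apply: leq_trans hd.
have [x [x_ge0 xz xv vpos]] := value_threshold hp1 d.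
have xvx j (jd : (j < d)%N) := xv x j (lexx x) jd.
have x0 : 0 < x.
  (* The weight condition for [j = 0] reads [crit_weight p <= x]. *)
  by apply: lt_le_trans (crit_weight_gt0 hp1) _; have := xvx 0%N d0; rewrite mulr1.
have xd : value p d x = 0.
  by move/eqP: xz; rewrite mulf_eq0 gt_eqF//= => /eqP.
exists (extremal_poly p d x), (x `^ p^-1) => f a.
have fn0 : f != 0 := extremal_complex_neq0.
have fs : (size f <= d.+1)%N := size_extremal_complex.
have ft : tmin p (coefs f) = (x `^ p^-1)%:C := extremal_tmin hp1 hp2 x0 xvx xd.
split; [split|split].
- by [].
- move=> k; have [kd|kd] := leqP k d; last by rewrite /a extremal_eq0.
  by apply/ltW; exact: (extremal_gt0 hp1 x0 xvx).
- split=> //; apply/eqP; rewrite eq_le; apply/andP; split.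
    apply: ge_ereal_sup => _ [g [gs g0] <-]; rewrite lee_fin.
    rewrite /tmin; case: xgetP => [tau _ taumin|_].
      exact: (minimizer_modulus_le hp1 x_ge0 xv vpos gs g0 taumin).
    (* Without a minimizer, [tmin] takes its default value 0, which respects the bound. *)
    by rewrite (_ : modulus 0 = 0) ?powR_ge0//; apply/eqP; rewrite modulus_eq0.
  apply: ereal_sup_ubound; exists f => //.
  by rewrite ft modulus_real ger0_norm// powR_ge0.
- by move=> _ k kd; exact: (extremal_neq0 hp1 hp2 x0 xvx).
- by move=> k kd; rewrite (extremal_left hp1 hp2 x0 xvx kd) (extremal_right hp1 hp2 x0 xvx xd kd).
- by move=> s; have [] := is_derive_hfun_extremal hp1 (d := d) (x := x) s.
move=> s; rewrite derive1E; have [_ ->] := is_derive_hfun_extremal hp1 (d := d) (x := x) s.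
rewrite -(slope_extremal_eq0 hp1 hp2 x0 xvx xd s); split=> [/eqP|->]; last by rewrite mulr0.
by rewrite mulf_eq0 oppr_eq0 gt_eqF ?orFb; [move/eqP|lra].
Qed.
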